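(* Let $\mathcal{S} = \{A_1, \ldots, A_n\}$ be a set of hierarchically structured classes (i.e., organized as a directed acyclic graph). Let $D \geq 1$ and let $h$ be a neural network with one output for each class, i.e., functions $h_{A_1}, \ldots, h_{A_n} \colon \mathbb{R}^D \to [0,1]$. For each class $A \in \mathcal{S}$, let $\mathcal{D}_A$ be the set of subclasses of $A$ in $\mathcal{S}$, and define, for every $x \in \mathbb{R}^D$, $$\mathrm{MCM}_A(x) = \max_{B \in \mathcal{D}_A} h_B(x).$$ Let $\text{C-HMCNN}(h)$ be the model whose output for each class $A\in\mathcal{S}$ is $\mathrm{MCM}_A$. Then $\text{C-HMCNN}(h)$ does not admit hierarchy violations; that is, there are no classes $A, B \in \mathcal{S}$ with $A$ a subclass of $B$ and no datapoint $x \in \mathbb{R}^D$ such that $\mathrm{MCM}_A(x) > \mathrm{MCM}_B(x)$.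
   Context: The classes in the finite set $\mathcal{S}$ are the vertices of a directed acyclic graph (DAG), the hierarchy. If there is a path of length $\geq 0$ from a class $A$ to a class $B$ in the DAG, then $B$ is called a subclass of $A$; in particular every class is a subclass of itself, so $A \in \mathcal{D}_A$, where $\mathcal{D}_A$ denotes the set of subclasses of $A$ in $\mathcal{S}$. A model $m$ assigns to each class $A$ a mapping $m_A \colon \mathbb{R}^D \to [0,1]$ (a datapoint $x$ is predicted to belong to $A$ whenever $m_A(x)$ is at least a user-defined threshold). The model $m$ has a hierarchy violation if there are classes $A, B$ with $A$ a subclass of $B$ and some $x \in \mathbb{R}^D$ with $m_A(x) > m_B(x)$. The neural network $h$ is arbitrary: only the fact that it yields functions $h_{A_i}\colon \mathbb{R}^D \to [0,1]$ matters. *)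

(* Defs.v *)
From mathcomp Require Import all_boot all_order all_algebra.
From mathcomp Require Import interval_inference reals.

Set Implicit Arguments.
Unset Strict Implicit.
Unset Printing Implicit Defensive.

Import Order.TTheory GRing.Theory Num.Theory.
Local Open Scope ring_scope.

(* A hierarchy is a relation [e] on a finite type of classes: [e A B] is an
   edge from the superclass [A] to the class [B]. A loop [e A A] gives the
   nonempty cycle [:: A], so it is excluded as well. *)
Definition is_dag (S : finType) (e : rel S) : Prop :=
  forall c : seq S, cycle e c -> c = [::].

Definition subclass (S : finType) (e : rel S) (B A : S) : bool :=
  connect e A B.

Definition subclasses (S : finType) (e : rel S) (A : S) : {set S} :=
  [set B | subclass e B A].

Definition model (R : realType) (D : nat) (S : finType) : Type :=
  S -> 'rV[R]_D -> {i01 R}.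

Definition hierarchy_violation (R : realType) (D : nat) (S : finType)
    (e : rel S) (m : model R D S) : Prop :=
  exists A B : S, subclass e A B /\
    exists x : 'rV[R]_D, (m A x)%:num > (m B x)%:num.

(* Since [A] is one of its own subclasses, starting the iterated maximum at
   [h A x] does not add any value to those over which it is taken. *)
Definition MCM (R : realType) (D : nat) (S : finType)
    (e : rel S) (h : model R D S) (A : S) (x : 'rV[R]_D) : {i01 R} :=
  \big[Order.max/h A x]_(B in subclasses e A) h B x.

Definition C_HMCNN (R : realType) (D : nat) (S : finType)
    (e : rel S) (h : model R D S) : model R D S :=
  fun A : S => MCM e h A.

(* Main.v *)
Require Import Defs.
From mathcomp Require Import all_boot all_order all_algebra.
From mathcomp Require Import interval_inference reals.

Import Order.TTheory.

(** Paths compose, so passing from a class to a superclass only enlarges the set over which the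
    maximum is taken, and a maximum over a larger set cannot be smaller. Hence [MCM] is monotone
    along the hierarchy ([MCM_le]), which rules out any strict violation. *)

Lemma subclasses_sub (S : finType) (e : rel S) (A B : S) :
  subclass e A B -> subclasses e A \subset subclasses e B.
Proof.
move=> sAB; apply/subsetP => C; rewrite !inE.
exact: connect_trans.
Qed.

Lemma MCM_le (R : realType) (D : nat) (S : finType) (e : rel S)
    (h : model R D S) (A B : S) (x : 'rV[R]_D) :
  subclass e A B -> (MCM e h A x <= MCM e h B x)%O.
Proof.
move=> sAB.
have le_hB C : C \in subclasses e B -> (h C x <= MCM e h B x)%O.
  exact: (le_bigmax_cond _ (fun C => h C x)).
(* The starting value [h A x] of the iterated maximum needs its own bound: [A] is itself among the
   subclasses of [B]. *)
apply/bigmax_leP; split=> [|C sCA]; apply: le_hB; first by rewrite inE.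
exact: (subsetP (subclasses_sub _ _ _ _ sAB)).
Qed.

Theorem theorem4p1 (R : realType) (D : nat) (hD : (1 <= D)%N)
    (S : finType) (e : rel S) (hdag : is_dag e) (h : model R D S) :
  ~ hierarchy_violation e (C_HMCNN e h).
Proof.
case=> A [B [sAB [x]]].
by rewrite num_lt ltNge MCM_le.
Qed.
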